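(* Let $I=[a,b]\subset\mathbb{R}$, let $\varphi:I\to I$, and let $f:I\to[0,\infty)$ be a $\varphi$-Godunova-Levin function. Let $t_1,\dots,t_n\in(0,1)$ with $\sum_{i=1}^n t_i=1$, and let $x_1,\dots,x_n\in I$. Then $$f\left(\sum_{i=1}^n t_i\varphi(x_i)\right)\le\sum_{i=1}^n\frac{f(\varphi(x_i))}{t_i}.$$
   Context: A function $f:I\to[0,\infty)$ is a $\varphi$-Godunova-Levin function if $f(t\varphi(x)+(1-t)\varphi(y))\le \frac{f(\varphi(x))}{t}+\frac{f(\varphi(y))}{1-t}$ for all $x,y\in I$ and $t\in(0,1)$. *)

(* Defs.v *)
From HB Require Import structures.
From mathcomp Require Import all_boot all_order all_algebra.
From mathcomp Require Import reals.
Set Implicit Arguments.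
Unset Strict Implicit.
Unset Printing Implicit Defensive.
Import Order.TTheory GRing.Theory Num.Theory.
Local Open Scope ring_scope.

(* Maps with domain I are total functions on R of which only the values on I
   matter: when phi maps I to I, every argument of f below lies in I, because
   an interval is convex. *)
Definition phi_godunova_levin (R : realType) (I : interval R)
    (phi f : R -> R) : Prop :=
  forall x y t : R, x \in I -> y \in I -> t \in `]0, 1[ ->
    f (t * phi x + (1 - t) * phi y) <= f (phi x) / t + f (phi y) / (1 - t).

(* Main.v *)
(* The induction one would use for Jensen's inequality is not available: a
   convex combination of values of phi need not be a value of phi. Instead, let
   p_j and p_k be the least and the greatest of the points p_i = phi (x_i). The
   barycenter s is l p_j + (1 - l) p_k with l >= t_j and 1 - l >= t_k, since
   every other point also splits nonnegatively between p_j and p_k. One use of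
   the hypothesis gives f(s) <= f(p_j) / t_j + f(p_k) / t_k. *)

Require Import Defs.
From HB Require Import structures.
From mathcomp Require Import all_boot all_order all_algebra.
From mathcomp Require Import reals ring.
Set Implicit Arguments.
Unset Strict Implicit.
Unset Printing Implicit Defensive.
Import Order.TTheory GRing.Theory Num.Theory.
Local Open Scope ring_scope.

Lemma ler_sum_term (R : numDomainType) (I : finType) (F : I -> R) (i : I) :
  (forall j, 0 <= F j) -> F i <= \sum_j F j.
Proof. by move=> F_ge0; rewrite (bigD1 i) //= lerDl sumr_ge0. Qed.

Lemma ler_sum_term2 (R : numDomainType) (I : finType) (F : I -> R) (i k : I) :
  (forall j, 0 <= F j) -> i != k -> F i + F k <= \sum_j F j.
Proof.
move=> F_ge0 neq_ik; rewrite (bigD1 i) //= (bigD1 k) 1?eq_sym //= addrA.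
by rewrite lerDl sumr_ge0.
Qed.

Theorem theorem4 (R : realType) (a b : R) (phi f : R -> R)
  (phi_I : forall x : R, x \in `[a, b] -> phi x \in `[a, b])
  (f_ge0 : forall x : R, x \in `[a, b] -> 0 <= f x)
  (f_GL : phi_godunova_levin `[a, b] phi f)
  (n : nat) (t x : 'I_n -> R)
  (t01 : forall i : 'I_n, t i \in `]0, 1[)
  (t_sum : \sum_(i < n) t i = 1)
  (x_I : forall i : 'I_n, x i \in `[a, b]) :
  f (\sum_(i < n) t i * phi (x i)) <= \sum_(i < n) f (phi (x i)) / t i.
Proof.
have t_gt0 i : 0 < t i by move: (t01 i); rewrite in_itv => /andP[].
have t_lt1 i : t i < 1 by move: (t01 i); rewrite in_itv => /andP[].
pose p i := phi (x i); pose s := \sum_(i < n) t i * p i.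
have fp_ge0 i : 0 <= f (p i) by apply/f_ge0/phi_I.
have term_ge0 i : 0 <= f (p i) / t i by rewrite divr_ge0 // ltW.
(* [t_sum] excludes [n = 0], where the sum would be 0; some index is needed before extrema can be
   taken. *)
have [i0 _] : exists i0 : 'I_n, true.
  case: n t t_sum {t01 x x_I t_gt0 t_lt1 p s fp_ge0 term_ge0} => [|n] t.
    by rewrite big_ord0 => /esym/eqP; rewrite oner_eq0.
  by exists ord0.
have [j p_min] : exists j, forall i, p j <= p i.
  by case: (@arg_minP _ _ _ i0 xpredT p) => // j _ h; exists j => i; apply: h.
have [k p_max] : exists k, forall i, p i <= p k.
  by case: (@arg_maxP _ _ _ i0 xpredT p) => // k _ h; exists k => i; apply: h.
(* As the weights sum to 1, the deviations from any [c] average to [s - c]; at an extreme point they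
   all have one sign. *)
have sub_s c : \sum_(i < n) t i * (p i - c) = s - c.
  under eq_bigr do rewrite mulrBr.
  by rewrite sumrB -mulr_suml t_sum mul1r.
(* Only the term [j] of the average is kept; division by [p k - p j] will give [t j <= l]. *)
have tj_le : t j * (p k - p j) <= p k - s.
  have -> : p k - s = \sum_(i < n) t i * (p k - p i).
    rewrite -opprB -sub_s -sumrN; apply: eq_bigr => i _.
    by rewrite -mulrN opprB.
  apply: (@ler_sum_term _ _ (fun i => t i * (p k - p i))) => i.
  by rewrite mulr_ge0 ?subr_ge0 // ltW.
have tk_le : t k * (p k - p j) <= s - p j.
  rewrite -sub_s; apply: (@ler_sum_term _ _ (fun i => t i * (p i - p j))) => i.
  by rewrite mulr_ge0 ?subr_ge0 // ltW.
(* If the extremes coincide, [l] would be 0/0; but then every [p i] equals [s], and the term [j]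
   alone suffices because [t j < 1]. *)
rewrite -/s; have [eq_p|neq_p] := eqVneq (p j) (p k).
  have -> : s = p j.
    apply/eqP; rewrite -subr_eq0 -sub_s big1 // => i _.
    have -> : p i = p j by apply/le_anti; rewrite p_min eq_p p_max.
    by rewrite subrr mulr0.
  apply: le_trans (ler_sum_term j term_ge0).
  by rewrite ler_pdivlMr // ler_piMr // ltW.
have d_gt0 : 0 < p k - p j by rewrite subr_gt0 lt_neqAle neq_p p_min.
pose l := (p k - s) / (p k - p j).
have onem_l : 1 - l = (s - p j) / (p k - p j).
  by rewrite /l; field; rewrite gt_eqF.
have tj_l : t j <= l by rewrite ler_pdivlMr.
have tk_l : t k <= 1 - l by rewrite onem_l ler_pdivlMr.
have l_gt0 : 0 < l := lt_le_trans (t_gt0 j) tj_l.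
have l'_gt0 : 0 < 1 - l := lt_le_trans (t_gt0 k) tk_l.
have -> : s = l * phi (x j) + (1 - l) * phi (x k).
  by rewrite onem_l /l -/(p j) -/(p k); field; rewrite gt_eqF.
have l01 : l \in `]0, 1[ by rewrite in_itv /= l_gt0 -subr_gt0.
apply: le_trans (f_GL _ _ _ (x_I j) (x_I k) l01) _.
(* Distinct indices ensure that no term of the sum is counted twice. *)
have neq_jk : j != k by apply: contra_neq neq_p => ->.
apply: le_trans (ler_sum_term2 term_ge0 neq_jk).
(* The numerators are nonnegative, so shrinking [l] to [t j] and [1 - l] to [t k] cannot decrease
   the quotients. *)
by apply: lerD; apply: ler_wpM2l; rewrite ?fp_ge0 ?lef_pV2 ?posrE.
Qed.
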